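(* Let $G = \langle X \mid Y\rangle$ be a group with set of generators $X$ and set of relators $Y$, let $R$ be a commutative unital ring, and let $\sigma,\tau$ be $R$-algebra endomorphisms of the group ring $RG$ which are $R$-linear extensions of group endomorphisms of $G$. Let $f: X \to RG$ be a map and let $\tilde f: F(X)\to RG$ be its associated extension to the free group $F(X)$ on $X$ (defined in the context). Then $f$ can be extended to a $(\sigma,\tau)$-derivation $D$ of $RG$ if and only if $\tilde f(y) = 0$ for all $y \in Y$.
   Context: A $(\sigma,\tau)$-derivation of $RG$ is an $R$-linear map $D: RG\to RG$ with $D(\alpha\beta) = D(\alpha)\tau(\beta)+\sigma(\alpha)D(\beta)$ for all $\alpha,\beta\in RG$. $D$ extends $f$ if $D(x)=f(x)$ for all $x\in X$ (where $x$ is viewed as an element of $G\subseteq RG$). Let $F(X)$ be the free group on $X$, so that $Y\subseteq F(X)$ and $G\cong F(X)/Y^{F(X)}$, where $Y^{F(X)}$ is the normal closure of $Y$. Let $\tilde\sigma,\tilde\tau: F(X)\to G$ be the unique group homomorphisms with $\tilde\sigma(x)=\sigma(x)$, $\tilde\tau(x)=\tau(x)$ for all $x\in X$. The map $\tilde f: F(X)\to RG$ is the unique map with $\tilde f(x)=f(x)$ for $x\in X$ and $\tilde f(vw)=\tilde f(v)\tilde\tau(w)+\tilde\sigma(v)\tilde f(w)$ for all $v,w\in F(X)$. Explicitly, $\tilde f(1)=0$, $\tilde f(x)=f(x)$ and $\tilde f(x^{-1})=-\tilde\sigma(x^{-1})f(x)\tilde\tau(x^{-1})$ for $x\in X$,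 and for $w=x_1\cdots x_m$ with $x_i\in X\cup X^{-1}$, $\tilde f(w)=\sum_{i=1}^m\left(\prod_{j=1}^{i-1}\tilde\sigma(x_j)\right)\tilde f(x_i)\left(\prod_{j=i+1}^m\tilde\tau(x_j)\right)$. *)

(* Defs.v *)
From HB Require Import structures.
From mathcomp Require Import all_boot all_algebra finmap.
From mathcomp Require Import monalg.

Set Implicit Arguments.
Unset Strict Implicit.
Unset Printing Implicit Defensive.

Import GRing.Theory.

Local Open Scope fset_scope.
Local Open Scope ring_scope.

(* The group ring: finitely supported functions G -> R with the convolution
   product. monalg's own ring structure on {malg R[K]} is not usable here: it
   requires K to be a monoid without nontrivial units. R may be the zero ring,
   hence pzRing rather than algebra structures. *)
Definition groupRing (R : comPzRingType) (G : groupType) : Type := {malg R[G]}.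

Section GroupRing.
Context (R : comPzRingType) (G : groupType).
Local Notation RG := (groupRing R G).

HB.instance Definition _ := GRing.Zmodule.copy RG {malg R[G]}.

Implicit Types a b : RG.

Definition gr_scale (c : R) a : RG :=
  \sum_(g <- msupp a) << c * mcoeff g a *g g >>.

Definition gr_one : RG := << 1 *g 1%g >>.

Definition gr_mul a b : RG :=
  \sum_(g <- msupp a) \sum_(h <- msupp b)
     << mcoeff g a * mcoeff h b *g (g * h)%g >>.

Lemma gr_scaleE c a g : mcoeff g (gr_scale c a) = c * mcoeff g a.
Proof.
rewrite {2}[a]monalgE /gr_scale.
rewrite !raddf_sum mulr_sumr.
by apply/eq_bigr=> /= i _; rewrite !mcoeffU mulrnAr.
Qed.

Lemma gr_scaleA c1 c2 a : gr_scale c1 (gr_scale c2 a) = gr_scale (c1 * c2) a.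
Proof. by apply/malgP=> x; rewrite !gr_scaleE mulrA. Qed.

Lemma gr_scale1r : left_id 1 gr_scale.
Proof. by move=> a; apply/malgP=> x; rewrite !gr_scaleE mul1r. Qed.

Lemma gr_scaleDr : right_distributive gr_scale +%R.
Proof.
by move=> c a b; apply/malgP=> x; rewrite !(mcoeffD, gr_scaleE) mulrDr.
Qed.

Lemma gr_scaleDl a : {morph gr_scale^~ a : c1 c2 / c1 + c2}.
Proof. by move=> c d; apply/malgP=> x; rewrite !(mcoeffD, gr_scaleE) mulrDl. Qed.

HB.instance Definition _ := GRing.Zmodule_isLmodule.Build R RG
  gr_scaleA gr_scale1r gr_scaleDr gr_scaleDl.

Lemma gr_mulw (d1 d2 : {fset G}) a b :
  msupp a `<=` d1 -> msupp b `<=` d2 ->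
  gr_mul a b = \sum_(g <- d1) \sum_(h <- d2)
     << mcoeff g a * mcoeff h b *g (g * h)%g >>.
Proof.
move=> le1 le2; rewrite /gr_mul (big_fset_incl _ le1) /=.
  apply/eq_bigr=> k1 _; apply/big_fset_incl => // k _ /mcoeff_outdom ->.
  by rewrite mulr0 monalgU0.
move=> k _ /mcoeff_outdom g1k.
by rewrite big1 => // k' _; rewrite g1k mul0r monalgU0.
Qed.

Lemma gr_mulDl : left_distributive gr_mul +%R.
Proof.
move=> a b c; set d := msupp a `|` msupp b.
rewrite (@gr_mulw d (msupp c) (a + b)) ?msuppD_le //.
rewrite (@gr_mulw d (msupp c) a) ?fsubsetUl //.
rewrite (@gr_mulw d (msupp c) b) ?fsubsetUr //.
rewrite -big_split /=; apply/eq_bigr=> k1 _.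
rewrite -big_split /=; apply/eq_bigr=> k2 _.
by rewrite mcoeffD mulrDl monalgUD.
Qed.

Lemma gr_mulDr : right_distributive gr_mul +%R.
Proof.
move=> c a b; set d := msupp a `|` msupp b.
rewrite (@gr_mulw (msupp c) d c (a + b)) ?msuppD_le //.
rewrite (@gr_mulw (msupp c) d c a) ?fsubsetUl //.
rewrite (@gr_mulw (msupp c) d c b) ?fsubsetUr //.
rewrite -big_split /=; apply/eq_bigr=> k1 _.
rewrite -big_split /=; apply/eq_bigr=> k2 _.
by rewrite mcoeffD mulrDr monalgUD.
Qed.

Lemma gr_mul0l : left_zero 0 gr_mul.
Proof. by move=> a; rewrite /gr_mul msupp0 big_seq_fset0. Qed.

Lemma gr_mul0r : right_zero 0 gr_mul.
Proof.
by move=> a; rewrite /gr_mul big1 // => k _; rewrite msupp0 big_seq_fset0.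
Qed.

Lemma gr_mulUU (c d : R) (g h : G) :
  gr_mul << c *g g >> << d *g h >> = << c * d *g (g * h)%g >>.
Proof. by rewrite (gr_mulw msuppU_le msuppU_le) !big_seq_fset1 !mcoeffUU. Qed.

Lemma gr_ind (P : RG -> Prop) :
  P 0 -> (forall a b, P a -> P b -> P (a + b)) ->
  (forall c g, P << c *g g >>) -> forall a, P a.
Proof.
by move=> P0 PD PU a; rewrite [a]monalgE; apply: big_ind => // g _; apply: PU.
Qed.

Lemma gr_mulA : associative gr_mul.
Proof.
move=> a b c; elim/gr_ind: a => [|a a' IH IH'|r g].
- by rewrite !gr_mul0l.
- by rewrite !gr_mulDl IH IH'.
elim/gr_ind: b => [|b b' IH IH'|s h].
- by rewrite gr_mul0l gr_mul0r gr_mul0l.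
- by rewrite gr_mulDl !gr_mulDr gr_mulDl IH IH'.
elim/gr_ind: c => [|c c' IH IH'|t k].
- by rewrite !gr_mul0r.
- by rewrite !gr_mulDr IH IH'.
by rewrite !gr_mulUU mulrA mulgA.
Qed.

Lemma gr_mul1l : left_id gr_one gr_mul.
Proof.
move=> a; elim/gr_ind: a => [|a b IH IH'|r g]; first by rewrite gr_mul0r.
  by rewrite gr_mulDr IH IH'.
by rewrite gr_mulUU mul1r mul1g.
Qed.

Lemma gr_mul1r : right_id gr_one gr_mul.
Proof.
move=> a; elim/gr_ind: a => [|a b IH IH'|r g]; first by rewrite gr_mul0l.
  by rewrite gr_mulDl IH IH'.
by rewrite gr_mulUU mulr1 mulg1.
Qed.

HB.instance Definition _ := GRing.Zmodule_isPzRing.Build RG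
  gr_mulA gr_mul1l gr_mul1r gr_mulDl gr_mulDr.

Definition gr_elt (g : G) : RG := << 1 *g g >>.

Lemma gr_elt1 : gr_elt 1%g = 1.
Proof. by []. Qed.

Lemma gr_eltM g h : gr_elt (g * h)%g = gr_elt g * gr_elt h.
Proof. by rewrite [RHS]gr_mulUU mulr1. Qed.

End GroupRing.

Arguments gr_elt R {G} g.

(* The free group: reduced words over X * bool, where (x, false) stands for x
   and (x, true) for x^-1. *)
Section FreeGroup.
Context (X : choiceType).

Definition letter_inv (a : X * bool) : X * bool := (a.1, ~~ a.2).

Definition reduced (w : seq (X * bool)) : bool :=
  sorted [rel a b | b != letter_inv a] w.

Record freeGroup : Type := FreeGroup {
  fg_word :> seq (X * bool);
  fg_wordP : reduced fg_word }.

HB.instance Definition _ := [isSub for fg_word].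
HB.instance Definition _ := [Choice of freeGroup by <:].

Definition fg_push (a : X * bool) (w : seq (X * bool)) : seq (X * bool) :=
  if w is b :: w' then if b == letter_inv a then w' else a :: w else [:: a].

Definition fg_cat (u v : seq (X * bool)) : seq (X * bool) := foldr fg_push v u.

Definition fg_rev (u : seq (X * bool)) : seq (X * bool) :=
  rev [seq letter_inv a | a <- u].

Lemma letter_invK : involutive letter_inv.
Proof. by case=> x b; rewrite /letter_inv /= negbK. Qed.

Lemma fg_push_reduced a w : reduced w -> reduced (fg_push a w).
Proof.
case: w => [|b w] //= rw; case: ifP => [_|/negbT ne]; first exact: path_sorted rw.
by rewrite /reduced /= ne.
Qed.

Lemma fg_cat_reduced u v : reduced v -> reduced (fg_cat u v).
Proof. by move=> rv; elim: u => [|a u IHu] //=; apply: fg_push_reduced. Qed.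

Lemma fg_push_cons a w : reduced (a :: w) -> fg_push a w = a :: w.
Proof. by case: w => [|b w] //= /andP[/negbTE ->]. Qed.

Lemma fg_pushK a w : reduced w -> fg_push (letter_inv a) (fg_push a w) = w.
Proof.
case: w => [|b w] /= rw; first by rewrite letter_invK eqxx.
case: eqP => [eb|_] /=; last by rewrite letter_invK eqxx.
by rewrite eb in rw *; rewrite fg_push_cons.
Qed.

Lemma fg_cat_push a v w : reduced w ->
  fg_cat (fg_push a v) w = fg_push a (fg_cat v w).
Proof.
move=> rw; case: v => [|b v] //=; case: eqP => [->|_] //.
by have := fg_pushK (letter_inv a) (fg_cat_reduced v rw); rewrite letter_invK.
Qed.

Lemma fg_catA u v w : reduced w ->
  fg_cat u (fg_cat v w) = fg_cat (fg_cat u v) w.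
Proof. by move=> rw; elim: u => //= a u IHu; rewrite fg_cat_push // IHu. Qed.

Lemma fg_cat_rcons u a v : fg_cat (rcons u a) v = fg_cat u (fg_push a v).
Proof. by rewrite /fg_cat foldr_rcons. Qed.

Lemma fg_cats0 u : reduced u -> fg_cat u [::] = u.
Proof.
elim: u => [|a u IHu] //= ru; rewrite IHu ?fg_push_cons //.
exact: path_sorted ru.
Qed.

Lemma fg_revK : involutive fg_rev.
Proof.
by move=> u; rewrite /fg_rev map_rev revK -map_comp map_id_in // => a _ /=;
   rewrite letter_invK.
Qed.

Lemma fg_rev_reduced u : reduced u -> reduced (fg_rev u).
Proof.
rewrite /reduced /fg_rev rev_sorted sorted_map; apply: sub_sorted => a b /=.
by rewrite letter_invK eq_sym.
Qed.

Lemma fg_cat_rev u : fg_cat (fg_rev u) u = [::].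
Proof.
elim: u => [|a u IHu] //.
by rewrite {1}/fg_rev /= rev_cons fg_cat_rcons /= letter_invK eqxx.
Qed.

Definition fg_one : freeGroup := @FreeGroup [::] isT.
Definition fg_mul (u v : freeGroup) : freeGroup :=
  FreeGroup (fg_cat_reduced u (fg_wordP v)).
Definition fg_inv (u : freeGroup) : freeGroup :=
  FreeGroup (fg_rev_reduced (fg_wordP u)).

Lemma fg_mulA : associative fg_mul.
Proof. by move=> u v w; apply/val_inj/fg_catA/fg_wordP. Qed.
Lemma fg_mul1 : left_id fg_one fg_mul.
Proof. by move=> u; apply/val_inj. Qed.
Lemma fg_mulr1 : right_id fg_one fg_mul.
Proof. by move=> u; apply/val_inj/fg_cats0/fg_wordP. Qed.
Lemma fg_mulV : left_inverse fg_one fg_inv fg_mul.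
Proof. by move=> u; apply/val_inj/fg_cat_rev. Qed.
Lemma fg_mulrV : right_inverse fg_one fg_inv fg_mul.
Proof.
by move=> u; apply/val_inj; rewrite /= -{1}[fg_word u]fg_revK fg_cat_rev.
Qed.

HB.instance Definition _ := isGroup.Build freeGroup
  fg_mulA fg_mul1 fg_mulr1 fg_mulV fg_mulrV.

Definition fg_gen (x : X) : freeGroup := @FreeGroup [:: (x, false)] isT.

Lemma fg_ind (P : freeGroup -> Prop) :
  P 1%g -> (forall x w, P w -> P (fg_gen x * w)%g) ->
  (forall x w, P w -> P ((fg_gen x)^-1 * w)%g) -> forall w, P w.
Proof.
move=> P1 PM PV [w rw]; elim: w rw => [|[x b] w IHw] rw.
  by have -> : FreeGroup rw = 1%g by apply/val_inj.
have rw' : reduced w by apply: path_sorted rw.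
case: b rw => rw.
  suff -> : FreeGroup rw = ((fg_gen x)^-1 * FreeGroup rw')%g by apply: PV.
  by apply/val_inj; rewrite /= -fg_push_cons.
suff -> : FreeGroup rw = (fg_gen x * FreeGroup rw')%g by apply: PM.
by apply/val_inj; rewrite /= -fg_push_cons.
Qed.

End FreeGroup.

Section Lift.
Context (X : choiceType) (H : groupType) (h : X -> H).
Local Open Scope group_scope.

Definition letter_eval (a : X * bool) : H :=
  if a.2 then (h a.1)^-1 else h a.1.

Definition word_eval (w : seq (X * bool)) : H := \prod_(a <- w) letter_eval a.

(* The unique homomorphism F(X) -> H that extends h. *)
Definition fg_lift (w : freeGroup X) : H := word_eval w.

Lemma letter_evalV a : letter_eval (letter_inv a) = (letter_eval a)^-1.
Proof. by case: a => x [] //=; rewrite /letter_eval /= invgK. Qed.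

Lemma word_eval_cons a w : word_eval (a :: w) = letter_eval a * word_eval w.
Proof. exact: big_cons. Qed.

Lemma word_eval_push a w : word_eval (fg_push a w) = letter_eval a * word_eval w.
Proof.
case: w => [|b w] /=; first by rewrite word_eval_cons.
case: eqP => [->|_]; rewrite !word_eval_cons //.
by rewrite letter_evalV mulgA mulgV mul1g.
Qed.

Lemma fg_liftM : {morph fg_lift : u v / u * v}.
Proof.
move=> u v; rewrite /fg_lift /=; elim: (fg_word u) => [|a w IHw] /=.
  by rewrite {2}/word_eval big_nil mul1g.
by rewrite word_eval_push IHw word_eval_cons mulgA.
Qed.

Lemma fg_lift1 : fg_lift 1 = 1.
Proof. exact: big_nil. Qed.

HB.instance Definition _ :=
  isUMagmaMorphism.Build (freeGroup X) H fg_lift (fg_lift1, fg_liftM).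

Lemma fg_lift_gen x : fg_lift (fg_gen x) = h x.
Proof. exact: big_seq1. Qed.

Lemma fg_lift_uniq (p : {multiplicative freeGroup X -> H}) :
  (forall x, p (fg_gen x) = h x) -> p =1 fg_lift.
Proof.
have p1 : p 1 = 1 by apply: (mulgI (p 1)); rewrite -gmulfM !mulg1.
move=> ph; elim/fg_ind => [|x w IHw|x w IHw]; rewrite ?p1 ?fg_lift1 //.
  by rewrite gmulfM fg_liftM IHw ph fg_lift_gen.
rewrite gmulfM fg_liftM IHw; congr (_ * _).
apply: (mulgI (h x)); rewrite -{1}ph -{1}fg_lift_gen -gmulfM -fg_liftM.
by rewrite mulgV p1 fg_lift1.
Qed.

End Lift.

Section Presentation.
Local Open Scope group_scope.

Definition normal_subgroup (F : groupType) (N : F -> Prop) : Prop :=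
  [/\ N 1, forall u v, N u -> N v -> N (u * v),
      forall u, N u -> N u^-1 & forall u v, N u -> N (u ^ v)].

Definition normal_closure (F : groupType) (Y : F -> Prop) (w : F) : Prop :=
  forall N : F -> Prop,
    normal_subgroup N -> (forall y, Y y -> N y) -> N w.

(* G = < X | Y >, where iota : X -> G sends a generator to the element of G
   that it denotes: the homomorphism F(X) -> G that extends iota is onto and
   its kernel is the normal closure of Y. *)
Definition presentation (X : choiceType) (G : groupType) (iota : X -> G)
    (Y : freeGroup X -> Prop) : Prop :=
  (forall g : G, exists w, fg_lift iota w = g) /\
  (forall w, fg_lift iota w = 1 <-> normal_closure Y w).

End Presentation.

Section Derivation.
Context (R : comPzRingType) (G : groupType).
Local Notation RG := (groupRing R G).

Definition extends_group_endo (s : {multiplicative G -> G}) (sigma : RG -> RG)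
  : Prop := forall g, sigma (gr_elt R g) = gr_elt R (s g).

Definition twisted_derivation (sigma tau : RG -> RG) (D : {linear RG -> RG})
  : Prop := forall a b, D (a * b) = D a * tau b + sigma a * D b.

Section Extension.
(* p and q are the values of sigma and tau on the generators, so fg_lift p and
   fg_lift q are the induced homomorphisms F(X) -> G. *)
Context (X : choiceType) (p q : X -> G) (f : X -> RG).

Definition letter_ext (a : X * bool) : RG :=
  if a.2 then - (gr_elt R (p a.1)^-1%g * f a.1 * gr_elt R (q a.1)^-1%g)
  else f a.1.

(* fg_ext is characterised by fg_ext_gen, fg_extM and fg_ext_uniq below. *)
Definition word_ext (w : seq (X * bool)) : RG :=
  \sum_(i < size w)
     gr_elt R (word_eval p (take i w)) * letter_ext (tnth (in_tuple w) i)
     * gr_elt R (word_eval q (drop i.+1 w)).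

Definition fg_ext (w : freeGroup X) : RG := word_ext w.

Lemma word_ext_cons a w : word_ext (a :: w) =
  letter_ext a * gr_elt R (word_eval q w)
  + gr_elt R (letter_eval p a) * word_ext w.
Proof.
rewrite /word_ext /= big_ord_recl /= {1}/word_eval big_nil gr_elt1 mul1r drop0.
rewrite (tnth_nth a) /=; congr (_ + _); rewrite mulr_sumr.
apply: eq_bigr => i _; rewrite /= word_eval_cons gr_eltM !mulrA.
by rewrite !(tnth_nth a) /=.
Qed.

Lemma word_ext_nil : word_ext [::] = 0.
Proof. exact: big_ord0. Qed.

Lemma letter_extV a : letter_ext (letter_inv a) =
  - (gr_elt R (letter_eval p a)^-1%g * letter_ext a
     * gr_elt R (letter_eval q a)^-1%g).
Proof.
case: a => x [] //=; rewrite /letter_ext /letter_eval /= !invgK.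
by rewrite mulrN mulNr opprK !mulrA -gr_eltM -!mulrA -gr_eltM mulgV mulVg
   !gr_elt1 mulr1 mul1r.
Qed.

Lemma word_ext_push a w : word_ext (fg_push a w) =
  letter_ext a * gr_elt R (word_eval q w)
  + gr_elt R (letter_eval p a) * word_ext w.
Proof.
case: w => [|b w] /=; first by rewrite word_ext_cons.
case: eqP => [->|_]; last by rewrite word_ext_cons.
rewrite word_ext_cons word_eval_cons letter_extV !letter_evalV.
rewrite mulrDr !mulrA -gr_eltM mulgV gr_elt1 mul1r addrA.
rewrite gr_eltM mulrN mulNr !mulrA -gr_eltM mulgV gr_elt1 mul1r.
by rewrite addrN add0r.
Qed.

Lemma fg_ext_gen x : fg_ext (fg_gen x) = f x.
Proof.
rewrite /fg_ext /= word_ext_cons word_ext_nil mulr0 addr0.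
by rewrite /word_eval big_nil gr_elt1 mulr1.
Qed.

Lemma fg_extM (v w : freeGroup X) : fg_ext (v * w)%g =
  fg_ext v * gr_elt R (fg_lift q w) + gr_elt R (fg_lift p v) * fg_ext w.
Proof.
rewrite /fg_ext /fg_lift /=; elim: (fg_word v) => [|a u IHu] /=.
  by rewrite word_ext_nil mul0r add0r /word_eval big_nil gr_elt1 mul1r.
rewrite word_ext_push IHu word_ext_cons word_eval_cons gr_eltM.
have -> : word_eval q (fg_cat u w) = (word_eval q u * word_eval q w)%g.
  elim: (u) => [|b u' IH] /=; first by rewrite /word_eval big_nil mul1g.
  by rewrite word_eval_push IH word_eval_cons mulgA.
by rewrite gr_eltM mulrDr mulrDl !mulrA addrA.
Qed.

Lemma fg_ext_uniq (e : freeGroup X -> RG) :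
  (forall x, e (fg_gen x) = f x) ->
  (forall v w, e (v * w)%g =
     e v * gr_elt R (fg_lift q w) + gr_elt R (fg_lift p v) * e w) ->
  e =1 fg_ext.
Proof.
have uV (d : freeGroup X -> RG) : (forall x, d (fg_gen x) = f x) ->
    (forall v w, d (v * w)%g =
      d v * gr_elt R (fg_lift q w) + gr_elt R (fg_lift p v) * d w) ->
    d 1%g = 0 /\ forall x, d (fg_gen x)^-1%g =
      - (gr_elt R (p x)^-1%g * f x * gr_elt R (q x)^-1%g).
  move=> dX dM; have d1 : d 1%g = 0.
    have := dM 1%g 1%g; rewrite !fg_lift1 !gr_elt1 mulr1 mul1r mulg1 => /eqP.
    by rewrite -subr_eq0 opprD addNKr oppr_eq0 => /eqP.
  split=> // x; have := dM (fg_gen x) (fg_gen x)^-1%g.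
  have liftV h : fg_lift h (fg_gen x)^-1%g = (h x)^-1%g :> G by exact: big_seq1.
  rewrite mulgV d1 dX fg_lift_gen liftV => /esym/eqP; rewrite addr_eq0 => /eqP E.
  by rewrite -mulrA E mulrN mulrA -gr_eltM mulVg gr_elt1 mul1r opprK.
move=> eX eM; have [e1 eV] := uV e eX eM.
have [g1 gV] := uV fg_ext fg_ext_gen fg_extM.
elim/fg_ind => [|x w IHw|x w IHw]; first by rewrite e1 g1.
  by rewrite eM fg_extM IHw eX fg_ext_gen.
by rewrite eM fg_extM IHw eV gV.
Qed.

End Extension.
End Derivation.

(* Main.v *)
Require Import Defs.
From HB Require Import structures.
From mathcomp Require Import all_boot all_algebra.
From mathcomp Require Import finmap monalg.

(** A twisted derivation is determined by its values on the group elements,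
    where the Leibniz rule makes it a twisted cocycle
      [d (g h) = d g * t h + s g * d h]    with values in RG,
    and conversely every such cocycle on G extends R-linearly to a derivation,
    since both sides of the Leibniz rule are bilinear.  So the question is when
    the values f on generators come from a cocycle on G.  On the free group
    there is always exactly one cocycle with these values, namely [fg_ext], and
    the question becomes when it factors through the projection
    [fg_lift iota : F(X) -> G].

    If D exists, then pulling the cocycle of D back to F(X) gives [fg_ext] by
    uniqueness ([twisted_derivation_fg_ext]), and it kills the relators because
    [D 1 = 0].  Conversely, the elements of the kernel of [fg_lift iota] at
    which [fg_ext] vanishes form a normal subgroup ([fg_ext_ker_normal]).  If it
    contains the relators then it contains their normal closure, which is the
    whole kernel; hence the cocycle depends only on the image of its argument in
    G ([fg_ext_factor]), and it can be computed on G along any set-theoretic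
    section of the projection. *)

Set Implicit Arguments.
Unset Strict Implicit.
Unset Printing Implicit Defensive.

Import GRing.Theory.

Local Open Scope ring_scope.

Section LinearExtension.
Context (R : comPzRingType) (G : groupType).
Local Notation RG := (groupRing R G).
Local Open Scope fset_scope.
Local Open Scope ring_scope.

Lemma monalgU_scale (c : R) (g : G) : << c *g g >> = c *: gr_elt R g :> RG.
Proof.
by apply/malgP => h; rewrite [RHS]gr_scaleE !mcoeffU mulrnAr mulr1.
Qed.

Lemma groupRing_mulUU (c d : R) (g h : G) :
  (<< c *g g >> : RG) * << d *g h >> = << c * d *g (g * h)%g >>.
Proof. exact: gr_mulUU. Qed.

Lemma gr_scalerAl (c : R) (a b : RG) : c *: (a * b) = (c *: a) * b.
Proof.
elim/gr_ind: a => [|a a' IH IH'|r g]; first by rewrite !(mul0r, scaler0).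
  by rewrite !(mulrDl, scalerDr) IH IH'.
elim/gr_ind: b => [|b b' IH IH'|u h]; first by rewrite !(mulr0, scaler0).
  by rewrite !(mulrDr, scalerDr) IH IH'.
rewrite groupRing_mulUU !monalgU_scale !scalerA -!monalgU_scale.
by rewrite groupRing_mulUU mulrA.
Qed.

Lemma gr_scalerAr (c : R) (a b : RG) : c *: (a * b) = a * (c *: b).
Proof.
elim/gr_ind: a => [|a a' IH IH'|r g]; first by rewrite !(mul0r, scaler0).
  by rewrite !(mulrDl, scalerDr) IH IH'.
elim/gr_ind: b => [|b b' IH IH'|u h]; first by rewrite !(mulr0, scaler0).
  by rewrite !(mulrDr, scalerDr) IH IH'.
rewrite groupRing_mulUU !monalgU_scale !scalerA -!monalgU_scale.
by rewrite groupRing_mulUU mulrCA.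
Qed.

(** RG is spanned by G, so a property stable under linear combinations need
    only be checked on group elements. *)
Lemma gr_lin_ind (P : RG -> Prop) :
  P 0 -> (forall a b, P a -> P b -> P (a + b)) ->
  (forall c a, P a -> P (c *: a)) -> (forall g, P (gr_elt R g)) ->
  forall a, P a.
Proof.
move=> P0 PD PZ PG; apply: gr_ind => // c g.
by rewrite monalgU_scale; apply: PZ.
Qed.

Context (V : lmodType R) (d : G -> V).

Definition gr_extend (a : RG) : V :=
  \sum_(g <- msupp a) mcoeff g a *: d g.

(** Summing over any finite set that contains the support lets elements with
    different supports be added termwise. *)
Lemma gr_extendw (A : {fset G}) (a : RG) : msupp a `<=` A ->
  gr_extend a = \sum_(g <- A) mcoeff g a *: d g.
Proof.
move=> sA; apply: big_fset_incl => // g _ /mcoeff_outdom ->.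
by rewrite scale0r.
Qed.

Lemma gr_extend_linear : linear gr_extend.
Proof.
move=> c a b; set A := msupp (c *: a + b) `|` (msupp a `|` msupp b).
rewrite (@gr_extendw A) ?fsubsetUl // (@gr_extendw A a); last first.
  by rewrite /A fsetUCA fsubsetUl.
rewrite (@gr_extendw A b); last by rewrite /A fsetUA fsubsetUr.
rewrite scaler_sumr -big_split /=; apply: eq_bigr => g _.
by rewrite mcoeffD [mcoeff g (c *: a)]gr_scaleE scalerDl scalerA.
Qed.

HB.instance Definition _ :=
  GRing.isLinear.Build R RG V *:%R gr_extend gr_extend_linear.

Lemma gr_extend_elt g : gr_extend (gr_elt R g) = d g.
Proof.
by rewrite (gr_extendw msuppU_le) big_seq_fset1 mcoeffUU scale1r.
Qed.

End LinearExtension.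

Lemma multiplicative1 (G H : groupType) (u : {multiplicative G -> H}) :
  u 1%g = 1%g.
Proof. by apply: (mulgI (u 1%g)); rewrite -gmulfM !mulg1. Qed.

Section TwistedDerivation.
Context (R : comPzRingType) (G : groupType) (s t : {multiplicative G -> G}).
Local Notation RG := (groupRing R G).
Context (sigma tau : {rmorphism RG -> RG}).
Hypothesis (sigma_ext : extends_group_endo s sigma).
Hypothesis (tau_ext : extends_group_endo t tau).

Lemma twisted_derivation1 (D : {linear RG -> RG}) :
  twisted_derivation sigma tau D -> D 1 = 0.
Proof.
move=> DM; have := DM 1 1; rewrite !rmorph1 !mulr1 mul1r => /eqP.
by rewrite -subr_eq0 opprD addNKr oppr_eq0 => /eqP.
Qed.

(** Both sides of the Leibniz rule are bilinear in its two arguments, so it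
    holds as soon as it holds on pairs of group elements. *)
Lemma gr_extend_derivation (d : G -> RG) :
  scalable sigma -> scalable tau ->
  (forall g h, d (g * h)%g =
     d g * gr_elt R (t h) + gr_elt R (s g) * d h) ->
  twisted_derivation sigma tau (gr_extend d).
Proof.
move=> sigmaZ tauZ dM a b; elim/gr_lin_ind: a => [|a a' IH IH'|c a IH|g].
- by rewrite mul0r !linear0 rmorph0 !mul0r addr0.
- by rewrite mulrDl !linearD IH IH' rmorphD /= !mulrDl addrACA.
- by rewrite -gr_scalerAl !linearZ IH sigmaZ /= scalerDr !gr_scalerAl.
elim/gr_lin_ind: b => [|b b' IH IH'|c b IH|h].
- by rewrite mulr0 !linear0 rmorph0 !mulr0 addr0.
- by rewrite mulrDr !linearD IH IH' rmorphD /= !mulrDr addrACA.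
- by rewrite -gr_scalerAr !linearZ IH tauZ /= scalerDr !gr_scalerAr.
by rewrite -gr_eltM /= !gr_extend_elt sigma_ext tau_ext.
Qed.

Context (X : choiceType) (iota : X -> G) (f : X -> RG).
Local Notation ext := (fg_ext (fun x => s (iota x)) (fun x => t (iota x)) f).

Lemma fg_lift_comp (u : {multiplicative G -> G}) w :
  fg_lift (fun x => u (iota x)) w = u (fg_lift iota w).
Proof.
pose h := (u \o fg_lift iota)%FUN.
by rewrite -(@fg_lift_uniq _ _ _ h) // => x; rewrite /h /= fg_lift_gen.
Qed.

Lemma fg_extM_endo v w : ext (v * w)%g =
  ext v * gr_elt R (t (fg_lift iota w)) + gr_elt R (s (fg_lift iota v)) * ext w.
Proof. by rewrite fg_extM !fg_lift_comp. Qed.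

(** The Leibniz rule for D turns into the product rule that characterises
    [fg_ext] among functions on F(X). *)
Lemma twisted_derivation_fg_ext (D : {linear RG -> RG}) :
  twisted_derivation sigma tau D ->
  (forall x, D (gr_elt R (iota x)) = f x) ->
  forall w, D (gr_elt R (fg_lift iota w)) = ext w.
Proof.
move=> DM Df w; pose e v := D (gr_elt R (fg_lift iota v)).
rewrite -[LHS]/(e w).
apply: fg_ext_uniq => [x|v v']; first by rewrite /e fg_lift_gen.
by rewrite /e fg_liftM gr_eltM DM sigma_ext tau_ext !fg_lift_comp.
Qed.

(** On the kernel of [fg_lift iota] both twists are trivial, so the cocycle is
    there an additive homomorphism; conjugation by v only multiplies its values
    by units of RG. *)
Lemma fg_ext_ker_normal :
  normal_subgroup (fun w => fg_lift iota w = 1%g /\ ext w = 0).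
Proof.
have ext1 : ext 1%g = 0 by exact: word_ext_nil.
split=> [|u v [u1 eu] [v1 ev]|u [u1 eu]|u v [u1 eu]].
- by rewrite fg_lift1.
- by rewrite fg_liftM u1 v1 mulg1 fg_extM_endo eu ev mul0r mulr0 addr0.
- have uV1 : fg_lift iota u^-1%g = 1%g by rewrite gmulfV /= u1 invg1.
  split=> //; have := fg_extM_endo u u^-1%g.
  by rewrite mulgV ext1 eu u1 mul0r add0r multiplicative1 gr_elt1 mul1r.
- split; first by rewrite gmulfJ /= u1 conj1g.
  rewrite conjgE !fg_extM_endo eu mul0r add0r fg_liftM u1 mul1g.
  by rewrite multiplicative1 gr_elt1 mul1r -fg_extM_endo mulVg.
Qed.

(** For v and w over the same element of G, the quotient [v * w^-1] lies in the
    normal closure of Y, so its cocycle value is 0; the product rule applied to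
    [v = (v * w^-1) * w] then leaves only the value at w. *)
Lemma fg_ext_factor (Y : freeGroup X -> Prop) :
  presentation iota Y -> (forall y, Y y -> ext y = 0) ->
  forall v w, fg_lift iota v = fg_lift iota w -> ext v = ext w.
Proof.
move=> [_ kerY] Y0 v w evw.
have vw1 : fg_lift iota (v * w^-1)%g = 1%g.
  by rewrite fg_liftM gmulfV /= evw mulgV.
have [] := (kerY _).1 vw1 _ fg_ext_ker_normal.
  by move=> y Yy; split; [apply/kerY => N _; apply | apply: Y0].
move=> _ e0; rewrite -[v](mulgVK w) fg_extM_endo e0 vw1.
by rewrite mul0r add0r multiplicative1 gr_elt1 mul1r.
Qed.

End TwistedDerivation.

Theorem theorem3p6 (X : choiceType) (G : groupType) (iota : X -> G)
    (Y : freeGroup X -> Prop) (hG : presentation iota Y)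
    (R : comPzRingType)
    (s t : {multiplicative G -> G})
    (sigma tau : {rmorphism groupRing R G -> groupRing R G})
    (sigma_lin : scalable sigma) (tau_lin : scalable tau)
    (sigma_ext : extends_group_endo s sigma)
    (tau_ext : extends_group_endo t tau)
    (f : X -> groupRing R G) :
  (exists D : {linear groupRing R G -> groupRing R G},
     twisted_derivation sigma tau D /\
     (forall x : X, D (gr_elt R (iota x)) = f x))
  <->
  (forall y : freeGroup X, Y y ->
     fg_ext (fun x => s (iota x)) (fun x => t (iota x)) f y = 0).
Proof.
split=> [[D [DM Df]] y Yy|Y0].
  have y1 : fg_lift iota y = 1%g by apply/hG.2 => N _; apply.
  rewrite -(twisted_derivation_fg_ext sigma_ext tau_ext DM Df) y1.
  exact: twisted_derivation1 DM.
have factor := fg_ext_factor hG Y0.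
have surj g : exists w, fg_lift iota w == g.
  by have [w <-] := hG.1 g; exists w.
(* r is a set-theoretic section: r (g * h) and r g * r h may differ in F(X),
   but they lie over the same element of G, where [factor] applies. *)
pose r g := xchoose (surj g).
have rK g : fg_lift iota (r g) = g by exact/eqP/(xchooseP (surj g)).
pose d g := fg_ext (fun x => s (iota x)) (fun x => t (iota x)) f (r g).
exists (gr_extend d); split=> [|x].
  apply: (gr_extend_derivation sigma_ext tau_ext sigma_lin tau_lin) => g h.
  rewrite -[X in s X](rK g) -[X in t X](rK h) -fg_extM_endo.
  by apply: factor; rewrite fg_liftM !rK.
rewrite /= gr_extend_elt.
rewrite -(fg_ext_gen (fun x => s (iota x)) (fun x => t (iota x)) f).
by apply: factor; rewrite rK fg_lift_gen.
Qed.
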